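(* For all positive integers $k$ and $d$, $m^*(k,d,1)=d+2(k-1)$.
   Context: For a finite set $X\subset\mathbb{R}^d$, a hyperplane ($(d-1)$-plane) $L$ is a complete Kneser $(d-1)$-transversal of $X$ if $L$ intersects $\operatorname{conv}(K)$ for every $k$-element subset $K\subseteq X$ and $L$ contains $d$ points of $X$. $m^*(k,d,1)$ is the maximum positive integer $n$ such that every set of $n$ points (not necessarily in general position) in $\mathbb{R}^d$ has a complete Kneser $(d-1)$-transversal to the convex hulls of its $k$-subsets. *)

(* Defs.v *)
From mathcomp Require Import all_boot all_order all_algebra finmap.
From mathcomp Require Import boolp classical_sets reals convex.

Set Implicit Arguments.
Unset Strict Implicit.
Unset Printing Implicit Defensive.

Import Order.TTheory GRing.Theory Num.Theory.
Local Open Scope classical_set_scope.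
Local Open Scope ring_scope.

Definition convex_hull (R : realType) (d : nat) (A : set 'rV[R]_d) :
    set 'rV[R]_d :=
  smallest (@convex_set R 'rV[R]_d) A.

Definition is_plane (R : realType) (d m : nat) (L : set 'rV[R]_d) : Prop :=
  exists (p : 'rV[R]_d) (V : {vspace 'rV[R]_d}),
    \dim V = m /\ L = [set x | x - p \in V].

(* Points of X beyond d may lie on L: X is not assumed in general position. *)
Definition complete_kneser_transversal (R : realType) (k d : nat)
    (X : {fset 'rV[R]_d}) (L : set 'rV[R]_d) : Prop :=
  [/\ is_plane (d - 1)%N L,
      forall K : {fset 'rV[R]_d}, (K `<=` X)%fset -> #|` K| = k ->
        L `&` convex_hull [set` K] !=set0
    & exists2 Y : {fset 'rV[R]_d}, (Y `<=` X)%fset &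
        #|` Y| = d /\ [set` Y] `<=` L].

Definition has_transversals (R : realType) (k d n : nat) : Prop :=
  forall X : {fset 'rV[R]_d}, #|` X| = n ->
    exists L : set 'rV[R]_d, complete_kneser_transversal k X L.

(* [m_star_is R k d m] reads m^*(k, d, 1) = m in the space R^d. *)
Definition m_star_is (R : realType) (k d m : nat) : Prop :=
  [/\ (0 < m)%N, has_transversals R k d m
    & forall n : nat, (0 < n)%N -> has_transversals R k d n -> (n <= m)%N].

(* Main.v *)
Require Import Defs.
From mathcomp Require Import all_boot all_order all_algebra finmap.
From mathcomp Require Import boolp classical_sets reals convex interval_inference.
From mathcomp Require Import zify ring lra.

Set Implicit Arguments.
Unset Strict Implicit.
Unset Printing Implicit Defensive.

Import Order.TTheory GRing.Theory Num.Theory.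
Local Open Scope classical_set_scope.
Local Open Scope ring_scope.

(** A hyperplane meets every [conv K] with [#|K| = k] as soon as each of its open
    sides contains at most [q := k - 1] points, and only then.

    Such a hyperplane through [d] of [d + 2q] points is found by induction on
    [d], for families with repetitions.  Take [p] of maximal norm: the linear
    form [y |-> <p, p - y>] is positive on the points other than [p], so central
    projection from [p] maps these to [R^(d-1)], and a hyperplane there lifts to
    one through [p].  For [d = 1] take a median.

    Conversely, a hyperplane meets the moment curve in at most [d] points, so it
    leaves at least [2q + 1] of any [d + 2q + 1] points of the curve off it, hence
    more than [q] on one side. *)

(** * Balanced hyperplanes: medians and central projection *)

Definition affine_form (R : pzRingType) n (a : 'cV[R]_n) (b : R) (x : 'rV[R]_n) : R :=
  (x *m a) 0 0 + b.

(** The sorted entry of index [(size s)./2] works: halving a length of at most [2 * q + 1] leaves at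
    most [q] entries before it and at most [q] after it. *)
Lemma median (R : realDomainType) (q : nat) (s : seq R) :
  (0 < size s <= (2 * q).+1)%N ->
  exists m, [/\ m \in s, (count (< m) s <= q)%N & (count (> m) s <= q)%N].
Proof.
case/andP=> s_gt0 s_le; set t := sort <=%R s.
have t_sorted : sorted <=%O t by exact: (sort_sorted le_total).
have st : perm_eq t s by apply/permPl/perm_sort.
have sz_t : size t = size s by rewrite size_sort.
have i_lt : ((size s)./2 < size t)%N by rewrite sz_t; lia.
pose m := nth 0 t (size s)./2.
have low : (count (< m) t <= (size s)./2)%N.
  by rewrite leqNgt; apply/negP => /(nth_count_lt 0 t_sorted); rewrite ltxx.
have high : ((size s)./2 < count (<= m) t)%N.
  rewrite ltnNge; apply/negP => i_ge.
  have := nth_count_gt 0 t_sorted (introT andP (conj i_ge i_lt)).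
  by rewrite ltxx.
exists m; split.
- by rewrite -(perm_mem st) mem_nth.
- by rewrite -(permP st); apply: leq_trans low _; lia.
- rewrite -(permP st) -(subKn (count_size (> m) t)) -count_le_gt sz_t.
  by rewrite leq_subLR (leq_trans _ (leq_add high (leqnn q))) //; lia.
Qed.

Lemma mxD00 (R : zmodType) (A C : 'M[R]_1) : (A + C) 0 0 = A 0 0 + C 0 0.
Proof. exact: mxE. Qed.

Lemma mxN00 (R : zmodType) (A : 'M[R]_1) : (- A) 0 0 = - (A 0 0).
Proof. exact: mxE. Qed.

Lemma mxZ00 (R : pzRingType) (t : R) (A : 'M[R]_1) : (t *: A) 0 0 = t * A 0 0.
Proof. exact: mxE. Qed.

(** Expand [0 < |x - y|^2 = |x|^2 - 2 <x, y> + |y|^2] and bound [|y|^2] by [|x|^2]. *)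
Lemma sub_dot_gt0 (R : realDomainType) n (x y : 'rV[R]_n) :
  (y *m y^T) 0 0 <= (x *m x^T) 0 0 -> y != x -> 0 < ((x - y) *m x^T) 0 0.
Proof.
move=> le_yx neq_yx.
have : 0 < ((x - y) *m (x - y)^T) 0 0.
  have ge0 i : true -> 0 <= (x - y) 0 i * (x - y)^T i 0.
    by move=> _; rewrite [X in _ * X]mxE -expr2 sqr_ge0.
  rewrite mxE lt_neqAle sumr_ge0 // andbT eq_sym psumr_eq0 //.
  apply: contra neq_yx => /allP x_y; rewrite eq_sym -subr_eq0.
  apply/eqP/rowP => i; have := x_y i (mem_index_enum _).
  by rewrite [(x - y)^T _ _]mxE -expr2 sqrf_eq0 => /eqP ->; rewrite mxE.
rewrite linearB /= mulmxBl !mulmxBr.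
have yxC : (x *m y^T) 0 0 = (y *m x^T) 0 0.
  by rewrite !mxE; apply: eq_bigr => i _; rewrite !mxE mulrC.
move: le_yx; rewrite mulmxBl.
rewrite !(mxD00, mxN00) yxC; lra.
Qed.

Lemma seq_argmax (T : eqType) (R : realDomainType) (f : T -> R) (s : seq T) :
  s != [::] -> exists2 p, p \in s & {in s, forall y, f y <= f p}.
Proof.
elim: s => // x [_ _|z s /(_ isT) [p ps p_max] _].
  by exists x; rewrite ?mem_head // => y; rewrite inE => /eqP ->.
have [xp|px] := leP (f x) (f p).
  exists p; first by rewrite in_cons ps orbT.
  by move=> y; rewrite in_cons => /predU1P[->|/p_max].
exists x; first exact: mem_head.
move=> y; rewrite in_cons => /predU1P[->//|/p_max yp].
exact: le_trans yp (ltW px).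
Qed.

(** The bound [minn (size s) d.+1] on the zeros is what survives the induction:
    copies of [p] are dropped by the projection, which may leave fewer points
    than the dimension. *)
Lemma balanced_hyperplane (R : realFieldType) (q d : nat) (s : seq 'rV[R]_d.+1) :
  (size s <= d.+1 + 2 * q)%N ->
  exists (a : 'cV[R]_d.+1) (b : R),
    [/\ a != 0, (count (fun x => (0 < affine_form a b x)%R) s <= q)%N,
        (count (fun x => (affine_form a b x < 0)%R) s <= q)%N
      & (minn (size s) d.+1 <= count (fun x => affine_form a b x == 0%R) s)%N].
Proof.
have nz n : const_mx 1 != 0 :> 'cV[R]_n.+1.
  by apply/eqP => /matrixP/(_ 0 0)/eqP; rewrite !mxE oner_eq0.
elim: d s => [|d IHd] s sz_s.
  have [->|s_n0] := eqVneq s [::]; first by exists (const_mx 1), 0; split=> //.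
  pose v (x : 'rV[R]_1) := x 0 0.
  have [m [ms m_lt m_gt]] : exists m, [/\ m \in map v s,
      (count (< m)%R (map v s) <= q)%N & (count (> m)%R (map v s) <= q)%N].
    by apply: median; rewrite size_map lt0n size_eq0 s_n0 /=; lia.
  have affE x : affine_form (const_mx 1) (- m) x = v x - m.
    by rewrite /affine_form mxE big_ord1 [const_mx _ _ _]mxE mulr1.
  exists (const_mx 1), (- m); split=> //.
  - apply: leq_trans m_gt; rewrite count_map; apply/eq_leq/eq_count => x /=.
    by rewrite affE subr_gt0.
  - apply: leq_trans m_lt; rewrite count_map; apply/eq_leq/eq_count => x /=.
    by rewrite affE subr_lt0.
  - rewrite geq_min; apply/orP; right; rewrite -has_count.
    by case/mapP: ms => x xs mx; apply/hasP; exists x; rewrite // affE mx subrr.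
have [->|s_n0] := eqVneq s [::].
  by exists (const_mx 1), 0; split=> //.
have [p ps p_max] := seq_argmax (fun x : 'rV_d.+2 => (x *m x^T) 0 0) s_n0.
pose c := p^T; pose f (y : 'rV[R]_d.+2) : R := ((p - y) *m c) 0 0.
have f_gt0 y : y \in s -> y != p -> 0 < f y.
  by move=> ys; apply: sub_dot_gt0; exact: p_max.
(* If [p = 0], then [f] vanishes identically, so all points coincide with [p] and any hyperplane
   through [p] will do. *)
have [c0|/matrix0Pn[i [j ci]]] := eqVneq c 0.
  have s_p y : y \in s -> y = p.
    move=> ys; apply/eqP/negPn/negP => /(f_gt0 y ys).
    by rewrite /f c0 mulmx0 mxE ltxx.
  pose a : 'cV[R]_d.+2 := const_mx 1.
  have affE y : y \in s -> affine_form a (- ((p *m a) 0 0)) y = 0.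
    by move=> /s_p ->; rewrite /affine_form subrr.
  exists a, (- ((p *m a) 0 0)); split=> //.
  - by rewrite (@eq_in_count _ _ pred0) ?count_pred0 // => y /affE ->; rewrite ltxx.
  - by rewrite (@eq_in_count _ _ pred0) ?count_pred0 // => y /affE ->; rewrite ltxx.
  - rewrite (@eq_in_count _ _ predT) ?count_predT ?geq_minl // => y /affE ->.
    exact: eqxx.
rewrite {j}ord1 in ci.
(* In coordinates, the projection of [y] is [(y - p) / f y] with the [i]-th entry
   deleted; this loses nothing as [c i 0 != 0]. *)
pose B : 'M[R]_(d.+2, d.+1) := col' i 1%:M.
pose z (y : 'rV[R]_d.+2) : 'rV[R]_d.+1 := (f y)^-1 *: ((y - p) *m B).
pose s' := [seq z y | y <- s & y != p].
have sz_s' : size s = (count_mem p s + size s')%N.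
  by rewrite size_map size_filter -(count_predC (pred1 p)).
have p_gt0 : (0 < count_mem p s)%N by rewrite -has_count has_pred1.
have [|a [b [a_n0 pos neg zero]]] := IHd s'.
  by rewrite -ltnS (leq_trans _ sz_s) // sz_s' -add1n leq_add2r.
(* Since [(y - p) *m c] is [- f y], the term [- b *: c] turns the constant [b] into [f y * b]: on
   [y - p], the form [a'] is [f y] times the form [(a, b)] at [z y]. *)
pose a' : 'cV[R]_d.+2 := B *m a - b *: c.
exists a', (- ((p *m a') 0 0)).
have affE y : affine_form a' (- ((p *m a') 0 0)) y = ((y - p) *m a') 0 0.
  by rewrite /affine_form mulmxBl mxD00 mxN00.
have aff_z y : y \in s -> y != p ->
    affine_form a' (- ((p *m a') 0 0)) y = f y * affine_form a b (z y).
  move=> ys /(f_gt0 y ys) fy_gt0.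
  rewrite affE mulmxBr -scalemxAr mxD00 mxN00 mxZ00.
  rewrite /affine_form mulrDr /z -scalemxAl mxZ00 mulrA.
  rewrite mulfV ?gt_eqF // mul1r mulmxA; congr (_ + _).
  by rewrite /f -(opprB y p) mulNmx mxN00 mulNr mulrC.
(* Signs survive multiplication by [f y > 0], so counts over [s] are counts over [s'], plus the
   copies of [p], where the form is zero. *)
have cntE (P : pred R) : (forall t u : R, 0 < t -> P (t * u) = P u) ->
    count (fun x => P (affine_form a' (- ((p *m a') 0 0)) x)) s =
    (P 0%R * count_mem p s + count (fun x => P (affine_form a b x)) s')%N.
  move=> P_scale; rewrite -[LHS](permP (permEl (perm_filterC (pred1 p) s))) count_cat.
  congr (_ + _)%N.
    rewrite (@eq_in_count _ _ (fun=> P 0)) => [|y]; last first.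
      rewrite mem_filter => /andP[/eqP -> _].
      by rewrite affE subrr mul0mx mxE.
    by case: (P 0); rewrite ?count_predT ?count_pred0 ?mul1n ?size_filter.
  rewrite count_map; apply: eq_in_count => y; rewrite mem_filter => /andP[yp ys].
  by rewrite /= aff_z // P_scale // f_gt0.
split.
(* If [a' = 0], its entry [i] forces [b = 0], hence [B *m a = 0]; deleting row [i] of [B] leaves the
   identity, so [a = 0]. *)
- have Bi : row i B = 0.
    apply/rowP => j; rewrite !mxE; case: eqP => // ij.
    by have := neq_lift i j; rewrite -ij eqxx.
  have a'i : a' i 0 = - (b * c i 0).
    have -> : a' i 0 = (row i a') 0 0 by rewrite [RHS]mxE.
    rewrite linearB /= row_mul Bi mul0mx sub0r linearZ /= mxN00 mxZ00.
    by rewrite [row _ _ _ _]mxE.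
  apply: contra_neq a_n0 => a'0; move: a'i; rewrite a'0 mxE => /esym/eqP.
  rewrite oppr_eq0 mulf_eq0 (negPf ci) orbF => /eqP b0.
  have BK : row' i B = 1%:M.
    by apply/matrixP => j k; rewrite !mxE (inj_eq lift_inj).
  rewrite -[a]mul1mx -BK row'Esub mul_rowsub_mx.
  have -> : B *m a = 0 by rewrite -[RHS]a'0 /a' b0 scale0r subr0.
  by apply/matrixP => j k; rewrite !mxE.
- by rewrite (cntE (fun t => 0 < t)) ?ltxx // => t u t_gt0; rewrite pmulr_rgt0.
- by rewrite (cntE (fun t => t < 0)) ?ltxx // => t u t_gt0; rewrite pmulr_rlt0.
- rewrite (cntE (fun t => t == 0)) => [|t u t_gt0]; last first.
    by rewrite mulf_eq0 gt_eqF.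
  (* At least one copy of [p] was dropped, and it makes up for the dimension lost. *)
  rewrite eqxx mul1n; apply: leq_trans (leq_add (leqnn _) zero).
  by rewrite addn_minr sz_s' geq_min leq_min; lia.
Qed.

(** * Hyperplanes as zero sets of affine forms *)

Lemma hyperplane_is_plane (R : realType) d (a : 'cV[R]_d.+1) (b : R) :
  a != 0 -> is_plane (d.+1 - 1)%N [set x | affine_form a b x = 0].
Proof.
case/matrix0Pn=> i [j ai]; rewrite {j}ord1 in ai.
pose f : 'Hom('rV[R]_d.+1, 'rV[R]_1) := linfun (mulmxr a).
(* As [e *m a = 1], the point [- b *: e] lies on the hyperplane, and rank-nullity gives the
   dimension of its direction. *)
pose e : 'rV[R]_d.+1 := (a i 0)^-1 *: delta_mx 0 i.
have e_a : e *m a = 1%:M.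
  by apply/matrixP => k l; rewrite !ord1 -scalemxAl -rowE !mxE mulVf.
exists (- b *: e), (lker f); split.
  have img : limg f = fullv.
    apply/eqP; rewrite eqEsubv subvf; apply/subvP => v _.
    have -> : v = f (v 0 0 *: e).
      rewrite lfunE /= -scalemxAl e_a.
      by apply/rowP => k; rewrite !ord1 mxZ00 !mxE mulr1.
    by rewrite memv_img ?memvf.
  have := limg_ker_dim f fullv; rewrite capfv img !dimvf !dim_matrix !mul1r.
  by move/(congr1 (subn^~ 1%N)); rewrite addnK.
have fE x : f (x - - b *: e) = (affine_form a b x)%:M.
  rewrite lfunE /= mulmxBl -scalemxAl e_a.
  apply/rowP => k; rewrite !ord1 mxD00 mxN00 mxZ00 [1%:M 0 0]mxE mulr1 opprK.
  by rewrite [RHS]mxE.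
apply/seteqP; split=> x /=; rewrite memv_ker fE.
  by move=> ->; rewrite raddf0.
by move=> /eqP/rowP/(_ 0); rewrite !mxE.
Qed.

(** The [d] basis vectors of the direction cannot span dimension [d.+1], so their matrix has a
    nonzero cokernel column, which is a form killing them all. *)
Lemma plane_sub_hyperplane (R : realType) d (L : set 'rV[R]_d.+1) :
  is_plane (d.+1 - 1)%N L ->
  exists (a : 'cV[R]_d.+1) (b : R),
    a != 0 /\ L `<=` [set x | affine_form a b x = 0].
Proof.
move=> [p [V [dimV ->]]]; rewrite subn1 /= in dimV.
pose M : 'M[R]_(\dim V, d.+1) := \matrix_i (vbasis V)`_i.
have : cokermx M != 0.
  rewrite cokermx_eq0 /row_full neq_ltn ltnS (leq_trans (rank_leq_row _)) //.
  by rewrite dimV.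
case/matrix0Pn=> i [j Mij]; pose a := col j (cokermx M).
have Ma : M *m a = 0 by rewrite /a colE mulmxA mulmx_coker mul0mx.
exists a, (- ((p *m a) 0 0)); split.
  by apply/matrix0Pn; exists i, 0; rewrite mxE.
move=> x /= /coord_vbasis xpE; rewrite /affine_form -mxN00 -mxD00 -mulmxBl xpE.
rewrite mulmx_suml summxE big1 // => k _.
have Vk : (vbasis V)`_k = row k M by rewrite rowK.
by rewrite Vk -scalemxAl mxZ00 -row_mul Ma !mxE mulr0.
Qed.

(** * Convex hulls and the sides of a hyperplane *)

Lemma affine_form_conv (R : realType) d (a : 'cV[R]_d) (b : R)
    (x y : convex_lmodType 'rV[R]_d) (t : {i01 R}) :
  affine_form a b (conv t x y) =
    t%:num * affine_form a b x + (1 - t%:num) * affine_form a b y.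
Proof.
rewrite /affine_form [conv t x y]/(t%:num *: (x : 'rV_d) + (1 - t%:num) *: (y : 'rV_d)).
by rewrite mulmxDl -!scalemxAl mxD00 !mxZ00 !mulrDr addrACA -mulrDl subrKC mul1r.
Qed.

(** An open half-space is convex, so it contains the hull of any set it contains. *)
Lemma convex_hull_pos (R : realType) d (a : 'cV[R]_d) (b : R) (A : set 'rV[R]_d) :
  (forall x, A x -> 0 < affine_form a b x) ->
  forall x, convex_hull A x -> 0 < affine_form a b x.
Proof.
move=> A_pos; apply: smallest_sub => // x y t; rewrite !inE /= => x_pos y_pos.
rewrite affine_form_conv.
have t_ge0 : 0 <= t%:num by [].
have t_le1 : t%:num <= 1 by [].
nra.
Qed.

Lemma convex_hull_cross (R : realType) d (a : 'cV[R]_d) (b : R)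
    (A : set 'rV[R]_d) (x y : 'rV[R]_d) :
  A x -> A y -> affine_form a b x <= 0 -> 0 <= affine_form a b y ->
  exists2 z, convex_hull A z & affine_form a b z = 0.
Proof.
move=> Ax Ay gx gy; have hullA u : A u -> convex_hull A u by exact: sub_gen_smallest.
have [gx0|gx_n0] := eqVneq (affine_form a b x) 0; first by exists x; first exact: hullA.
have gx_lt0 : affine_form a b x < 0 by rewrite lt_neqAle gx_n0.
(* The weight of [x] at which the form, affine along the segment, vanishes. *)
pose t := affine_form a b y / (affine_form a b y - affine_form a b x).
have D_gt0 : 0 < affine_form a b y - affine_form a b x by lra.
have t_ge0 : 0 <= t by rewrite divr_ge0 // ltW.
have t_le1 : t <= 1 by rewrite ler_pdivrMr // mul1r; lra.
exists (conv (Itv01 t_ge0 t_le1) (x : convex_lmodType 'rV[R]_d) y).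
  move=> C [cvxC sAC].
  by have := cvxC x y (Itv01 t_ge0 t_le1); rewrite !inE; apply; exact: sAC.
rewrite affine_form_conv /= /t; field; lra.
Qed.

(** * From counts to finite sets, and the lower bound *)

Lemma fset_of_uniq_seq (T : choiceType) (s : seq T) n :
  uniq s -> (n <= size s)%N ->
  exists K : {fset T}, #|` K| = n /\ {subset K <= s}.
Proof.
move=> s_uniq n_le; exists [fset x in take n s]%fset; split.
  by rewrite card_fseq undup_id ?take_uniq // size_takel.
by move=> x; rewrite inE => /mem_take.
Qed.

(** Pigeonhole: with [P] an open side holding at most [q] points, each [K] of [q.+1] points has one
    on the closed opposite side. *)
Lemma exists_outside (T : choiceType) (K X : {fset T}) (P : pred T) q :
  (K `<=` X)%fset -> (count P X <= q)%N -> (q < #|` K|)%N ->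
  exists2 x, x \in K & ~~ P x.
Proof.
move=> KX cnt q_lt; apply/allPn; apply: contraL q_lt => /allP PK.
rewrite -leqNgt (leq_trans _ cnt) // -size_filter uniq_leq_size ?fset_uniq //.
by move=> x xK; rewrite mem_filter PK //= (fsubsetP KX).
Qed.

Lemma has_transversals_balanced (R : realType) (q d : nat) :
  has_transversals R q.+1 d.+1 (d.+1 + 2 * q).
Proof.
move=> X cardX.
have [|a [b [a_n0 pos neg zero]]] := @balanced_hyperplane R q d X.
  by rewrite cardX.
exists [set x | affine_form a b x = 0]; split.
- exact: hyperplane_is_plane.
- move=> K KX cardK.
  have [x xK x_npos] := exists_outside KX pos (eq_leq (esym cardK)).
  have [y yK y_nneg] := exists_outside KX neg (eq_leq (esym cardK)).
  rewrite -leNgt in x_npos; rewrite -leNgt in y_nneg.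
  have [z hz gz] := @convex_hull_cross R d.+1 a b [set` K] x y xK yK x_npos y_nneg.
  by exists z.
- rewrite cardX (minn_idPr (leq_addr _ _)) -size_filter in zero.
  have [Y [cardY sY]] := fset_of_uniq_seq (filter_uniq _ (fset_uniq X)) zero.
  exists Y; first by apply/fsubsetP => x /sY; rewrite mem_filter => /andP[].
  by split=> // x /= /sY; rewrite mem_filter => /andP[/eqP].
Qed.

(** * The moment curve and the upper bound *)

Definition moment_curve (R : pzRingType) d (t : R) : 'rV[R]_d :=
  \row_j t ^+ j.+1.

(** Along the curve the form is a polynomial in [t] of degree at most [d], with constant term [b]
    and the entries of [a] as its other coefficients; it is nonzero, so it has at most [d] roots. *)
Lemma moment_curve_general_position (R : idomainType) d (a : 'cV[R]_d) (b : R)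
    (ts : seq R) :
  a != 0 -> uniq ts ->
  (count (fun t => affine_form a b (moment_curve d t) == 0%R) ts <= d)%N.
Proof.
move=> a_n0 ts_uniq; pose P := rVpoly a^T * 'X + b%:P.
have PE t : P.[t] = affine_form a b (moment_curve d t).
  rewrite /P hornerMXaddC horner_poly /affine_form mxE mulr_suml; congr (_ + _).
  by apply: eq_bigr => i _; rewrite valK !mxE exprSr -mulrA mulrC //.
have P_n0 : P != 0.
  apply: contra_neq a_n0 => P0; apply/trmx_inj; rewrite -[a^T]rVpolyK trmx0.
  suff -> : rVpoly a^T = 0 by rewrite linear0.
  apply/polyP => i; have := congr1 (fun p : {poly R} => p`_i.+1) P0.
  by rewrite coefD coefMX coefC addr0 !coef0.
rewrite -size_filter -ltnS (leq_trans (max_poly_roots P_n0 _ (filter_uniq _ ts_uniq))) //.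
  by apply/allP => t; rewrite mem_filter /root PE => /andP[].
rewrite (leq_trans (size_polyD _ _)) // geq_max (leq_trans (size_polyC_leq1 _)) //.
by rewrite (leq_trans (size_polyMleq _ _)) // size_polyX addn2 /= ltnS size_poly.
Qed.

Lemma moment_curve_inj (R : nzRingType) d : injective (@moment_curve R d.+1).
Proof. by move=> t u /rowP/(_ 0); rewrite !mxE !expr1. Qed.

Lemma affine_formN (R : pzRingType) d (a : 'cV[R]_d) (b : R) x :
  affine_form (- a) (- b) x = - affine_form a b x.
Proof. by rewrite /affine_form mulmxN mxN00 opprD. Qed.

Lemma has_transversals_bound (R : realType) (q d n : nat) :
  has_transversals R q.+1 d.+1 n -> (n <= d.+1 + 2 * q)%N.
Proof.
move=> transv; rewrite leqNgt; apply/negP => n_gt.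
pose ts : seq R := [seq i%:R | i <- iota 0 n].
have ts_uniq : uniq ts.
  by rewrite map_inj_uniq ?iota_uniq // => i j /eqP; rewrite eqr_nat => /eqP.
pose s := map (@moment_curve R d.+1) ts.
have s_uniq : uniq s by rewrite map_inj_uniq //; exact: moment_curve_inj.
have sz_s : size s = n by rewrite !size_map size_iota.
have [X [cardX sX]] := fset_of_uniq_seq s_uniq (eq_leq (esym sz_s)).
have Xs : {subset s <= X}.
  have [_ sXs] := uniq_min_size (fset_uniq X) sX (eq_leq (etrans sz_s (esym cardX))).
  by move=> x; rewrite -sXs.
have [L [plane_L meets _]] := transv X cardX.
have [a [b [a_n0 sL]]] := plane_sub_hyperplane plane_L.
(* Otherwise [q.+1] points lie strictly on one side, and their hull misses [L]. Using this for both
   [(a, b)] and [(- a, - b)] covers the two sides. *)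
have few_pos (a' : 'cV[R]_d.+1) b' : L `<=` [set x | affine_form a' b' x = 0] ->
    (count (fun x => (0 < affine_form a' b' x)%R) s <= q)%N.
  move=> sL'; rewrite leqNgt -size_filter; apply/negP => q_lt.
  have [K [cardK sK]] := fset_of_uniq_seq (filter_uniq _ s_uniq) q_lt.
  have KX : (K `<=` X)%fset.
    by apply/fsubsetP => x /sK; rewrite mem_filter => /andP[_ /Xs].
  have [z [/sL' /= gz hz]] := meets K KX cardK.
  suff : 0 < affine_form a' b' z by rewrite gz ltxx.
  by apply: convex_hull_pos hz => x /= /sK; rewrite mem_filter => /andP[].
have pos := few_pos a b sL.
have neg : (count (fun x => (affine_form a b x < 0)%R) s <= q)%N.
  under eq_count do rewrite -oppr_gt0 -affine_formN.
  by apply: few_pos => x /sL /= gx; rewrite affine_formN gx oppr0.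
have zero : (count (fun x => affine_form a b x == 0%R) s <= d.+1)%N.
  by rewrite count_map; exact: moment_curve_general_position.
(* Every point is positive, zero or negative for the form. *)
have : (n <= q + (d.+1 + q))%N.
  rewrite -sz_s -(count_predC (fun x => (0 < affine_form a b x)%R)) leq_add //.
  apply: leq_trans (leq_add zero neg); rewrite -count_predUI.
  apply: leq_trans (leq_addr _ _); apply: sub_count => x /=.
  by rewrite -leNgt le_eqVlt.
lia.
Qed.

Theorem theorem5 (R : realType) (k d : nat) (hk : (0 < k)%N) (hd : (0 < d)%N) :
  m_star_is R k d (d + 2 * (k - 1))%N.
Proof.
case: k hk => // q _; case: d hd => // d _; rewrite subn1 /=.
split=> //; first exact: has_transversals_balanced.
by move=> n _; exact: has_transversals_bound.
Qed.
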